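(* Let $\psi: T \to \mathbb{C}$ be a function and $\varphi: T \to T$ a self-map. Then $W_{\psi,\varphi}$, as an operator on $L_\mu^\infty$ (respectively $L_\mu^0$), is injective if and only if $\varphi$ is surjective and $S_w \cap Z^c \ne \emptyset$ for every $w \in T$, where $S_w = \varphi^{-1}(\varphi(w)) = \{v \in T : \varphi(v) = \varphi(w)\}$ and $Z^c = T \setminus Z$ with $Z = \psi^{-1}(0) = \{v \in T : \psi(v) = 0\}$.
   Context: $(T,\mathrm{d})$ is a metric space with a distinguished point $o$ (the root); the length of $v \in T$ is $|v| = \mathrm{d}(o,v)$. $T$ is assumed locally finite (for every $M>0$ the set $\{v \in T : |v| < M\}$ is finite) and unbounded (for every $M>0$ there is $v \in T$ with $|v| \ge M$). $\mu: T \to (0,\infty)$ is an arbitrary positive function (a weight). $L_\mu^\infty$ is the Banach space of functions $f: T \to \mathbb{C}$ with $\|f\|_\mu = \sup_{v \in T} \mu(v)|f(v)| < \infty$, and $L_\mu^0$ is its closed subspace of those $f$ with $\lim_{|v|\to\infty} \mu(v)|f(v)| = 0$. The weighted composition operator on $L_\mu^\infty$ (respectively $L_\mu^0$) is the linear map defined on that space by $W_{\psi,\varphi} f = \psi\,(f\circ\varphi)$. *)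

(* Defs.v *)
From HB Require Import structures.
From mathcomp Require Import all_boot all_order all_algebra.
From mathcomp Require Import all_classical all_reals all_analysis.
From mathcomp Require Import complex.

Set Implicit Arguments.
Unset Strict Implicit.
Unset Printing Implicit Defensive.

Import Order.TTheory GRing.Theory Num.Theory.
Import numFieldNormedType.Exports.

Local Open Scope classical_set_scope.
Local Open Scope ring_scope.

Section RootedMetricSpace.
Context {R : realType} {T : metricType R}.
Implicit Types o v : T.

Definition length o v : R := mdist o v.

Definition locally_finite o : Prop :=
  forall M : R, 0 < M -> finite_set [set v | length o v < M].

Definition unbounded o : Prop :=
  forall M : R, 0 < M -> exists v, M <= length o v.

(* The filter "|v| -> +oo" on T. *)
Definition length_infty o : set_system T :=
  filter_from [set: R] (fun M => [set v | M <= length o v]).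

#[global] Instance length_infty_filter o : Filter (length_infty o).
Proof.
apply: filter_from_filter; first by exists 0.
move=> M N _ _; exists (Num.max M N) => // v /=.
by rewrite ge_max => /andP[].
Qed.

Lemma length_infty_proper_filter o :
  unbounded o -> ProperFilter (length_infty o).
Proof.
move=> unb; apply: filter_from_proper => M _.
have [|v Mv] := unb (Num.max M 1); first by rewrite lt_max ltr01 orbT.
by exists v; apply: le_trans Mv; rewrite le_max lexx.
Qed.

End RootedMetricSpace.

Section WeightedSpaces.
Context {R : realType} {T : metricType R}.
Implicit Types (mu : T -> R) (f psi : T -> R[i]) (phi : T -> T).

(* [ComplexField.Normc.normc] is the R-valued modulus; [`|z|] lives in R[i]. *)
Definition weighted_modulus mu f (v : T) : R :=
  mu v * ComplexField.Normc.normc (f v).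

Definition weighted_norm mu f : \bar R :=
  ereal_sup (range (fun v => (weighted_modulus mu f v)%:E)).

Definition Linfty mu : set (T -> R[i]) :=
  [set f | (weighted_norm mu f < +oo)%E].

Definition L0 (o : T) mu : set (T -> R[i]) :=
  [set f | Linfty mu f /\
    weighted_modulus mu f v @[v --> length_infty o] --> (0 : R)].

(* The operator on a space is the restriction of this map to that space; it is
   not required to take values in the space again. *)
Definition weighted_comp psi phi f : T -> R[i] :=
  fun v => psi v * f (phi v).

Definition zero_set psi : set T := psi @^-1` [set 0].

Definition fiber_through phi (w : T) : set T := phi @^-1` [set phi w].

End WeightedSpaces.

(* Main.v *)
(** For a point [u] of [T], the indicator of [u] lies in both spaces and is sent
    by the operator to a function supported on the points [v] with
    [phi v = u] and [psi v <> 0]. Hence injectivity on either space is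
    equivalent to the existence of such a [v] for every [u]; a function of the
    space is then determined at [u] by its image at [v]. *)
Require Import Defs.
From HB Require Import structures.
From mathcomp Require Import all_boot all_order all_algebra.
From mathcomp Require Import all_classical all_reals all_analysis.
From mathcomp Require Import complex.

Import Order.TTheory GRing.Theory Num.Theory.
Import numFieldNormedType.Exports.

Local Open Scope classical_set_scope.
Local Open Scope ring_scope.

Definition point_indic {R : realType} {T : metricType R} (w : T) : T -> R[i] :=
  fun v => if `[< v = w >] then 1 else 0.

Lemma point_indicT (R : realType) (T : metricType R) (w : T) :
  point_indic w w = 1.
Proof. by rewrite /point_indic asboolT. Qed.

Lemma point_indicF (R : realType) (T : metricType R) (w v : T) :
  v <> w -> point_indic w v = 0.
Proof. by move=> vw; rewrite /point_indic asboolF. Qed.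

Lemma weighted_modulus0 (R : realType) (T : metricType R) (mu : T -> R)
    (f : T -> R[i]) (v : T) : f v = 0 -> weighted_modulus mu f v = 0.
Proof.
by move=> fv0; rewrite /weighted_modulus fv0 ComplexField.Normc.normc0 mulr0.
Qed.

Lemma Linfty_bounded (R : realType) (T : metricType R) (mu : T -> R)
    (f : T -> R[i]) (M : R) :
  (forall v, weighted_modulus mu f v <= M) -> Linfty mu f.
Proof.
move=> fM; apply: (@le_lt_trans _ _ M%:E); last exact: ltry.
by apply: ge_ereal_sup => _ [v _ <-]; rewrite lee_fin.
Qed.

(** Outside a ball around [o] the weighted modulus is constantly 0, so it converges to 0 along
    [length_infty o]. *)
Lemma L0_eventually0 (R : realType) (T : metricType R) (o : T) (mu : T -> R)
    (f : T -> R[i]) (M : R) :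
  Linfty mu f -> (forall v, M <= length o v -> f v = 0) -> L0 o mu f.
Proof.
move=> fmu f0; split => //; apply: cvg_near_cst; exists M => // v /f0.
exact: weighted_modulus0.
Qed.

Lemma Linfty0 (R : realType) (T : metricType R) (mu : T -> R) :
  Linfty mu (fun=> 0).
Proof. by apply: (@Linfty_bounded _ _ _ _ 0) => v; rewrite weighted_modulus0. Qed.

Lemma L00 (R : realType) (T : metricType R) (o : T) (mu : T -> R) :
  L0 o mu (fun=> 0).
Proof. by apply: (@L0_eventually0 _ _ _ _ _ 0) => //; exact: Linfty0. Qed.

Lemma Linfty_point_indic (R : realType) (T : metricType R) (mu : T -> R)
    (w : T) : Linfty mu (point_indic w).
Proof.
(* The weighted modulus is 0 away from [w], so the larger of 0 and its value at [w] bounds it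
   everywhere. *)
apply: (@Linfty_bounded _ _ _ _ (Num.max 0 (weighted_modulus mu (point_indic w) w))) => v.
have [->|vw] := pselect (v = w); first by rewrite le_max lexx orbT.
by rewrite weighted_modulus0 ?le_max ?lexx //; exact: point_indicF.
Qed.

Lemma L0_point_indic (R : realType) (T : metricType R) (o : T) (mu : T -> R)
    (w : T) : L0 o mu (point_indic w).
Proof.
(* Any radius strictly above [length o w] excludes [w], the only point of the support. *)
apply: (@L0_eventually0 _ _ _ _ _ (length o w + 1)).
  exact: Linfty_point_indic.
move=> v wv; apply: point_indicF => vw.
by move: wv; rewrite vw gerDl ler10.
Qed.

(** Membership of the zero function and of the point indicators is all that is asked of [X], so one
    proof serves both spaces. *)
Lemma weighted_comp_injP (R : realType) (T : metricType R)
    (X : set (T -> R[i])) (psi : T -> R[i]) (phi : T -> T) :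
  X (fun=> 0) -> (forall w, X (point_indic w)) ->
  set_inj X (weighted_comp psi phi) <->
  set_surj [set: T] [set: T] phi /\
  forall w : T, fiber_through phi w `&` ~` zero_set psi !=set0.
Proof.
move=> X0 X1; split => [inj|[surj fib] f g _ _ fg].
  have main u : exists2 v, phi v = u & psi v <> 0.
    apply: contrapT => nov.
    (* Without such a [v], the indicator of [u] and the zero function have the same image;
       injectivity identifies them, and evaluating at [u] gives 1 = 0. *)
    have /(congr1 (@^~ u)) : point_indic u = (fun=> 0 : R[i]).
      apply: inj; rewrite ?inE //; apply: funext => v.
      rewrite /weighted_comp mulr0.
      have [pu|/point_indicF->] := pselect (phi v = u); last exact: mulr0.
      have [->|pv] := pselect (psi v = 0); first exact: mul0r.
      by case: nov; exists v.
    by rewrite point_indicT => /eqP; rewrite oner_eq0.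
  (* Surjectivity forgets [psi v <> 0]; the fiber condition at [w] is [main] at the point
     [phi w]. *)
  split => [u _|w]; first by have [v] := main u; exists v.
  by have [v] := main (phi w); exists v.
(* Surjectivity puts [u] in the image, and the fiber over it then has a point [v] with [psi v <> 0];
   this factor cancels from the equality of the images at [v]. *)
apply: funext => u; have [w _ <-] := surj u I.
have [v [<- /eqP pv]] := fib w.
by move/(congr1 (@^~ v)): fg; exact: mulfI.
Qed.

Theorem theorem5p1 (R : realType) (T : metricType R) (o : T)
    (T_locally_finite : locally_finite o) (T_unbounded : unbounded o)
    (mu : T -> R) (mu_gt0 : forall v : T, 0 < mu v)
    (psi : T -> R[i]) (phi : T -> T) :
  (set_inj (Linfty mu) (weighted_comp psi phi) <->
     set_surj [set: T] [set: T] phi /\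
     forall w : T, fiber_through phi w `&` ~` zero_set psi !=set0) /\
  (set_inj (L0 o mu) (weighted_comp psi phi) <->
     set_surj [set: T] [set: T] phi /\
     forall w : T, fiber_through phi w `&` ~` zero_set psi !=set0).
Proof.
split; apply: weighted_comp_injP.
- exact: Linfty0.
- exact: Linfty_point_indic.
- exact: L00.
- exact: L0_point_indic.
Qed.
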